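(* Let $m\ge 2$ be an integer. The growth series $\Gamma_{J_m}(X)=\sum_{n\ge 0}\gamma_{J_m}(n)X^n$ of the automaton $J_m$ and the growth series $\Gamma_{S_{J_m}}(X)=\sum_{n\ge 0}\gamma_{S_{J_m}}(n)X^n$ of the monoid $S_{J_m}$ coincide and admit the description $$\Gamma_{J_m}(X)=\frac{1}{(1-X)^2}\left(1+\frac{X}{1-X}\left(1+\frac{X^m}{1-X^m}\left(1+\frac{X^{m^2}}{1-X^{m^2}}\left(1+\frac{X^{m^3}}{1-X^{m^3}}\left(1+\frac{X^{m^4}}{1-X^{m^4}}\left(1+\cdots\right)\right)\right)\right)\right)\right).$$
   Context: Let $X_m=\{x_0,\ldots,x_{m-1}\}$ and let $X_m^\omega$ be the set of right-infinite words over $X_m$. $J_m$ is the Mealy automaton over $X_m$ with three states $e,f_0,f_1$, which define the following transformations of $X_m^\omega$ (for all $w\in X_m^\omega$): $e$ is the identity; $f_0(x_i w)=x_0 w$ for $0\le i\le m-2$ and $f_0(x_{m-1}w)=x_0 f_0(w)$; $f_1(x_i w)=x_{i+1}w$ for $0\le i\le m-2$ and $f_1(x_{m-1}w)=x_0 f_1(w)$. $S_{J_m}$ is the semigroup of transformations of $X_m^\omega$ generated by $e,f_0,f_1$ under composition; it is a monoid with identity $e$. Length is taken relative to the generators $\{e,f_0,f_1\}$: $\ell(e)=0$, and for $s\ne e$, $\ell(s)$ is the least $l$ such that $s$ is a product of $l$ generators. $\gamma_{S_{J_m}}(n)$ is the number of $s\in S_{J_m}$ with $\ell(s)\le n$.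 The growth function $\gamma_{J_m}(n)$ of the automaton is the number of states of the minimal Mealy automaton equivalent to the $n$-th power $J_m^n$ (the $n$-fold product automaton, whose states are $n$-tuples of states of $J_m$, acting by composition), i.e. the number of distinct transformations of the form $g_1g_2\cdots g_n$ with $g_j\in\{e,f_0,f_1\}$; $\gamma_{J_m}(0)=1$. The nested expression is a formal power series; with the outer factor removed it means $1+\sum_{k\ge 0}\prod_{i=0}^{k}\frac{X^{m^i}}{1-X^{m^i}}$. *)

(* Defs.v *)
From HB Require Import structures.
From mathcomp Require Import all_boot all_order all_algebra finmap.
From mathcomp Require Import boolp classical_sets functions cardinality.

Set Implicit Arguments.
Unset Strict Implicit.
Unset Printing Implicit Defensive.

Import GRing.Theory.
Local Open Scope classical_set_scope.

Record mealy (X : finType) := Mealy {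
  mealy_state :> finType;
  mealy_next : mealy_state -> X -> mealy_state;
  mealy_out : mealy_state -> X -> X }.

Definition oword (X : finType) := nat -> X.

Definition ocons (X : finType) (x : X) (w : oword X) : oword X :=
  fun k => if k is k'.+1 then w k' else x.

Fixpoint mealy_run (X : finType) (A : mealy X) (q : A) (w : oword X) (k : nat) : A :=
  if k is k'.+1 then mealy_next (mealy_run q w k') (w k') else q.

Definition mealy_act (X : finType) (A : mealy X) (q : A) (w : oword X) : oword X :=
  fun k => mealy_out (mealy_run q w k) (w k).

Lemma mealy_act_cons (X : finType) (A : mealy X) (q : A) x w :
  mealy_act q (ocons x w) = ocons (mealy_out q x) (mealy_act (mealy_next q x) w).
Proof.
apply/funext => -[|k] //=; rewrite /mealy_act /=; congr mealy_out.
by elim: k => //= k ->.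
Qed.

(** The state [(p, q)] acts as [p \o q]: the letter is read by [q] first. *)
Definition mealy_prod (X : finType) (A B : mealy X) : mealy X :=
  @Mealy X (A * B)%type
    (fun s x => (mealy_next s.1 (mealy_out s.2 x), mealy_next s.2 x))
    (fun s x => mealy_out s.1 (mealy_out s.2 x)).

Definition mealy_one (X : finType) : mealy X :=
  @Mealy X unit (fun s _ => s) (fun _ x => x).

Fixpoint mealy_pow (X : finType) (A : mealy X) (n : nat) : mealy X :=
  if n is n'.+1 then mealy_prod A (mealy_pow A n') else mealy_one X.

Lemma mealy_act_prod (X : finType) (A B : mealy X) (p : A) (q : B) :
  mealy_act ((p, q) : mealy_prod A B) = mealy_act p \o mealy_act q.
Proof.
apply/funext => w; apply/funext => k; rewrite /mealy_act /=.
have -> : mealy_run ((p, q) : mealy_prod A B) w k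
          = (mealy_run p (mealy_act q w) k, mealy_run q w k) by elim: k => //= k ->.
by [].
Qed.

Definition transformations (X : finType) (A : mealy X) : set (oword X -> oword X) :=
  range (@mealy_act X A).

Definition mealy_equiv (X : finType) (A B : mealy X) : Prop :=
  transformations A = transformations B.

Definition equiv_size (X : finType) (A : mealy X) (k : nat) : bool :=
  `[< exists2 B : mealy X, mealy_equiv B A & #|B| = k >].

Lemma equiv_size_ex (X : finType) (A : mealy X) : exists k, equiv_size A k.
Proof. by exists #|A|; apply/asboolP; exists A. Qed.

(** The minimal automaton equivalent to [A] is the one with the fewest states. *)
Definition minimal_size (X : finType) (A : mealy X) : nat := ex_minn (equiv_size_ex A).

Definition automaton_growth (X : finType) (A : mealy X) (n : nat) : nat :=
  minimal_size (mealy_pow A n).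

Definition comp_closed (T : Type) (S : set (T -> T)) : Prop :=
  forall f g, S f -> S g -> S (f \o g).

Definition mealy_semigroup (X : finType) (A : mealy X) : set (oword X -> oword X) :=
  smallest (@comp_closed (oword X)) (transformations A).

Fixpoint products (T : Type) (G : set (T -> T)) (l : nat) : set (T -> T) :=
  if l is l'.+1 then [set f \o g | f in G & g in products G l'] else [set id].

Definition has_length (T : Type) (G : set (T -> T)) (s : T -> T) (l : nat) : Prop :=
  (s = id /\ l = 0) \/
  (s <> id /\ products G l s /\ forall l', products G l' s -> l <= l').

Definition ball (X : finType) (A : mealy X) (n : nat) : set (oword X -> oword X) :=
  [set s | mealy_semigroup A s /\
           exists2 l, has_length (transformations A) s l & l <= n].

Lemma finite_ball (X : finType) (A : mealy X) n : finite_set (ball A n).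
Proof.
have finP l : finite_set (products (transformations A) l).
  elim: l => [|l IHl] /=; first exact: finite_set1.
  by apply: finite_image2 => //; exact: finite_image (@finite_finset A setT).
apply: (@sub_finite_set _ _ (\bigcup_(l in `I_n.+1) products (transformations A) l)).
  by move=> s [_ [l [[-> ->]|[_ [sl _]]] ln]]; [exists 0|exists l].
by apply: bigcup_finite => //; exact: finite_II.
Qed.

(** [fset_set] is meaningful here by [finite_ball]. *)
Definition semigroup_growth (X : finType) (A : mealy X) (n : nat) : nat :=
  #|` fset_set (ball A n)|%fset.

Inductive J_state := J_e | J_f0 | J_f1.

Definition J_state_code (s : J_state) : option bool :=
  match s with J_e => None | J_f0 => Some false | J_f1 => Some true end.

Definition J_state_decode (s : option bool) : J_state :=
  match s with None => J_e | Some false => J_f0 | Some true => J_f1 end.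

Lemma J_state_codeK : cancel J_state_code J_state_decode.
Proof. by case. Qed.

HB.instance Definition _ := Equality.copy J_state (can_type J_state_codeK).
HB.instance Definition _ := Choice.copy J_state (can_type J_state_codeK).
HB.instance Definition _ := Countable.copy J_state (can_type J_state_codeK).
HB.instance Definition _ := Finite.copy J_state (can_type J_state_codeK).

Definition first_letter (m : nat) (i : 'I_m) : 'I_m :=
  Ordinal (leq_ltn_trans (leq0n i) (ltn_ord i)).

(** [ordS] is the cyclic successor on ['I_m]. *)
Definition J (m : nat) : mealy 'I_m :=
  @Mealy 'I_m J_state
    (fun s i => if i == m.-1 :> nat then s else J_e)
    (fun s i => match s with
                | J_e => i
                | J_f0 => first_letter i
                | J_f1 => ordS i
                end).

Lemma J_act_e m : mealy_act (J_e : J m) = id.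
Proof.
apply/funext => w; apply/funext => k; rewrite /mealy_act.
suff -> : mealy_run (J_e : J m) w k = J_e by [].
by elim: k => //= k ->; case: ifP.
Qed.

Lemma J_act_f0 m (i : 'I_m) w :
  mealy_act (J_f0 : J m) (ocons i w) =
  ocons (first_letter i) (if i == m.-1 :> nat then mealy_act (J_f0 : J m) w else w).
Proof. by rewrite mealy_act_cons /=; case: ifP; rewrite ?J_act_e. Qed.

Lemma J_act_f1 m (i : 'I_m) w :
  mealy_act (J_f1 : J m) (ocons i w) =
  ocons (ordS i) (if i == m.-1 :> nat then mealy_act (J_f1 : J m) w else w).
Proof. by rewrite mealy_act_cons /=; case: ifP; rewrite ?J_act_e. Qed.

Local Open Scope ring_scope.

Record fps (R : Type) := FPS { fps_coef : nat -> R }.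

HB.instance Definition _ (R : Type) := gen_eqMixin (fps R).
HB.instance Definition _ (R : Type) := gen_choiceMixin (fps R).

Lemma fps_ext (R : Type) (f g : fps R) : fps_coef f =1 fps_coef g -> f = g.
Proof. by case: f g => [f] [g] /= fg; congr FPS; apply/funext. Qed.

Section FPSRing.
Variable R : comUnitRingType.
Implicit Types f g h : fps R.

Definition fps_zero : fps R := FPS (fun _ => 0).
Definition fps_opp f : fps R := FPS (fun n => - fps_coef f n).
Definition fps_add f g : fps R := FPS (fun n => fps_coef f n + fps_coef g n).
Definition fps_one : fps R := FPS (fun n => (n == 0)%:R).
Definition fps_mul f g : fps R :=
  FPS (fun n => \sum_(i < n.+1) fps_coef f i * fps_coef g (n - i)).

Lemma fps_addA : associative fps_add.
Proof. by move=> f g h; apply: fps_ext => n; exact: addrA. Qed.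
Lemma fps_addC : commutative fps_add.
Proof. by move=> f g; apply: fps_ext => n; exact: addrC. Qed.
Lemma fps_add0 : left_id fps_zero fps_add.
Proof. by move=> f; apply: fps_ext => n; exact: add0r. Qed.
Lemma fps_addN : left_inverse fps_zero fps_opp fps_add.
Proof. by move=> f; apply: fps_ext => n; exact: addNr. Qed.

HB.instance Definition _ :=
  GRing.isZmodule.Build (fps R) fps_addA fps_addC fps_add0 fps_addN.

Let trunc N f : {poly R} := \poly_(i < N.+1) fps_coef f i.

Let truncE N f n : (n <= N)%N -> (trunc N f)`_n = fps_coef f n.
Proof. by move=> nN; rewrite coef_poly ltnS nN. Qed.

Let mul_trunc N f g n : (n <= N)%N ->
  fps_coef (fps_mul f g) n = (trunc N f * trunc N g)`_n.
Proof.
move=> nN; rewrite coefM; apply: eq_bigr => i _.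
have iN : (i <= n)%N by rewrite -ltnS.
by rewrite !truncE ?(leq_trans _ nN) ?leq_subr.
Qed.

Lemma fps_mulC : commutative fps_mul.
Proof.
by move=> f g; apply: fps_ext => n; rewrite !(mul_trunc _ _ (leqnn n)) mulrC.
Qed.

Lemma fps_mulA : associative fps_mul.
Proof.
move=> f g h; apply: fps_ext => n.
transitivity (trunc n f * (trunc n g * trunc n h))`_n.
  rewrite coefM; apply: eq_bigr => i _.
  by rewrite truncE -1?ltnS // (mul_trunc _ _ (leq_subr i n)).
rewrite mulrA coefM; apply: eq_bigr => i _.
by rewrite -mul_trunc -1?ltnS // truncE // leq_subr.
Qed.

Lemma fps_mul1 : left_id fps_one fps_mul.
Proof.
move=> f; apply: fps_ext => n /=.
by rewrite big_ord_recl /= mul1r subn0 big1 ?addr0 // => i _; rewrite mul0r.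
Qed.

Lemma fps_mulD : left_distributive fps_mul fps_add.
Proof.
move=> f g h; apply: fps_ext => n /=.
by rewrite -big_split; apply: eq_bigr => i _; rewrite mulrDl.
Qed.

Lemma fps_one_neq0 : fps_one != 0 :> fps R.
Proof.
apply/eqP => /(congr1 (fun f => fps_coef f 0)) /= /eqP.
by rewrite oner_eq0.
Qed.

HB.instance Definition _ := GRing.Zmodule_isComNzRing.Build (fps R)
  fps_mulA fps_mulC fps_mul1 fps_mulD fps_one_neq0.

Definition fps_unit : pred (fps R) := fun f => fps_coef f 0 \is a GRing.unit.

(** The first [n] coefficients of the inverse, obtained by solving
    [fps_mul f g = 1] coefficient by coefficient. *)
Fixpoint fps_inv_seq f (n : nat) : seq R :=
  if n is k.+1 then
    let s := fps_inv_seq f k in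
    rcons s ((fps_coef f 0)^-1 *
             ((k == 0)%:R - \sum_(i < k) s`_i * fps_coef f (k - i)))
  else [::].

Definition fps_inv f : fps R :=
  if f \in fps_unit then FPS (fun n => (fps_inv_seq f n.+1)`_n) else f.

Let size_inv_seq f n : size (fps_inv_seq f n) = n.
Proof. by elim: n => //= n IHn; rewrite size_rcons IHn. Qed.

Let nth_inv_seq f n i : (i < n)%N ->
  (fps_inv_seq f n)`_i = (fps_inv_seq f i.+1)`_i.
Proof.
elim: n => // n IHn; rewrite ltnS leq_eqVlt => /predU1P[-> //|lt_in].
by rewrite /= nth_rcons size_inv_seq lt_in IHn.
Qed.

Lemma fps_mulV : {in fps_unit, left_inverse 1 fps_inv *%R}.
Proof.
move=> f Uf; apply: fps_ext => n; rewrite /fps_inv Uf /=.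
rewrite big_ord_recr /= subnn nth_rcons size_inv_seq ltnn eqxx.
rewrite mulrAC mulVr // mul1r [X in _ + (_ - X)](_ : _ = \sum_(i < n)
  (fps_inv_seq f i.+1)`_i * fps_coef f (n - i)); last first.
  by apply: eq_bigr => i _; rewrite nth_inv_seq.
by rewrite addrC subrK.
Qed.

Lemma fps_unitP f g : g * f = 1 -> f \in fps_unit.
Proof.
move=> /(congr1 (fun h => fps_coef h 0)) /=; rewrite big_ord1 subnn => gf1.
by apply/unitrPr; exists (fps_coef g 0); rewrite mulrC.
Qed.

Lemma fps_inv_out : {in [predC fps_unit], fps_inv =1 id}.
Proof. by move=> f; rewrite inE /= /fps_inv => /negbTE ->. Qed.

HB.instance Definition _ := GRing.ComNzRing_hasMulInverse.Build (fps R)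
  fps_mulV fps_unitP fps_inv_out.

Definition fpsX : fps R := FPS (fun n => (n == 1)%:R).

(** Coefficientwise stabilisation, i.e. convergence for the [X]-adic topology. *)
Definition fps_cvg (u : nat -> fps R) f : Prop :=
  forall n, exists N, forall k, (N <= k)%N -> fps_coef (u k) n = fps_coef f n.

Definition fps_sums_to (u : nat -> fps R) f : Prop :=
  fps_cvg (fun K => \sum_(k < K) u k) f.

End FPSRing.

Definition growth_series (a : nat -> nat) : fps int := FPS (fun n => (a n)%:Z).

(* Main.v *)
Require Import Defs.
From mathcomp Require Import all_boot all_order all_algebra finmap.
From mathcomp Require Import boolp classical_sets cardinality.
From mathcomp Require Import zify.

Set Implicit Arguments.
Unset Strict Implicit.
Unset Printing Implicit Defensive.

(** Read an infinite word as an m-adic integer, lowest digit first.  Then [f1]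
    is the odometer [n |-> n + 1], and [f0] resets to zero the maximal run of
    digits [m - 1] at the bottom of the word together with the digit that
    follows it (the function [clear] below).  Since the transformations at hand
    are causal, each is determined by what it does to natural numbers, so every
    equality between products becomes an equality between functions on [nat].

    Normal forms.  If all values of [g] are multiples of [m ^ r] and [m ^ r]
    does not divide [a + 1], the digits of [a] below [m ^ r] are not all
    [m - 1], so [f0] applied to [a + g x] only sees these digits and
    [f0 f1^a g = f1^(clear a) g], a shorter product.  If [a + 1 = m ^ r (c + 1)],
    then [f0 f1^a g] takes its values in the multiples of [m ^ (r + 1)], and
    nothing can be simplified.  Starting from the identity ([r = 0]), every
    product of [n] generators is therefore equal to a product
      [f1^a . f0 f1^(m^(r-1) (c_(r-1) + 1) - 1) ... f0 f1^(m (c_1 + 1) - 1)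
           . f0 f1^((c_0 + 1) - 1)],
    of length [a + sum_(i < r) m ^ i (c_i + 1) <= n] ([products_nf_act]), and
    conversely such a product is padded with [e] to [n] factors.

    Distinct normal forms act differently ([tail_map_inj]).  The exponent [c_0]
    of the factor acting first is visible on the arguments [m ^ K - 1 - c_0]:
    there [f0] meets [m ^ K - 1] and erases it, so the result stays bounded as
    [K] grows, whereas for a larger exponent the summand [m ^ K] survives.  Once
    [c_0] is known, feeding multiples of [m] shifted by [c_0] and dividing the
    result by [m] removes the factor [f0 f1^(c_0)] from the product, and one
    argues by induction on [r].

    Counting.  A factor [X^(m^i) / (1 - X^(m^i))] enumerates the possible
    [c_i], one factor [1 / (1 - X)] enumerates [a], the other one passes from
    length exactly [n] to length at most [n].  Because [e] is among the
    generators, both growth functions at [n] count the products of exactly [n]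
    generators: for the automaton since merging states with equal action gives
    a minimal equivalent automaton ([minimal_sizeE]), for the monoid by
    [ballE]. *)

(** * The two generators on natural numbers *)

Section Naturals.
Variable m : nat.
Hypothesis hm : 1 < m.

(** [fuel] only bounds the recursion; [clearE] is the recursive equation that
    mirrors the automaton. *)
Fixpoint clear_rec (fuel n : nat) : nat :=
  if fuel is k.+1 then
    m * (if n %% m == m.-1 then clear_rec k (n %/ m) else n %/ m)
  else 0.

Definition clear (n : nat) : nat := clear_rec n.+1 n.

Lemma clear_rec_fuel k k' n : n < k -> n < k' -> clear_rec k n = clear_rec k' n.
Proof.
elim: k k' n => // k IHk [|k'] //= n nk nk'.
case: ifP => // /eqP nm; congr (m * _).
have n0 : 0 < n by case: n nm {nk nk'} => //; rewrite mod0n; lia.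
by apply: IHk; apply: (leq_trans (ltn_Pdiv hm n0)).
Qed.

Lemma clearE n :
  clear n = m * (if n %% m == m.-1 then clear (n %/ m) else n %/ m).
Proof.
rewrite {1}/clear /=; case: ifP => // /eqP nm; congr (m * _).
have n0 : 0 < n by case: n nm => //; rewrite mod0n; lia.
by apply: clear_rec_fuel => //; exact: ltn_Pdiv.
Qed.

Lemma clear_mulD q d :
  d < m -> clear (m * q + d) = m * (if d == m.-1 then clear q else q).
Proof.
move=> dm; rewrite clearE [m * q]mulnC modnMDl divnMDl; last by lia.
by rewrite modn_small // divn_small // addn0.
Qed.

Lemma clear_mul q : clear (m * q) = m * q.
Proof.
rewrite -[in LHS](addn0 (m * q)) clear_mulD; last by lia.
by case: eqP => //; lia.
Qed.

Lemma clear0 : clear 0 = 0.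
Proof. by have := clear_mul 0; rewrite muln0. Qed.

Lemma dvdn_clear n : m %| clear n.
Proof. by rewrite clearE dvdn_mulr. Qed.

Lemma clear_le n : clear n <= n.
Proof.
elim/ltn_ind: n => n IHn; rewrite clearE.
have nE := divn_eq n m; rewrite [X in _ <= X]nE mulnC.
case: ifP => [/eqP nm|_]; last by lia.
have n0 : 0 < n by case: n nm {nE IHn} => //; rewrite mod0n; lia.
have := IHn _ (ltn_Pdiv hm n0); rewrite -(leq_pmul2r (ltnW hm)); lia.
Qed.

Lemma pow_gt0 j : 0 < m ^ j.
Proof. by rewrite expn_gt0 ltnW. Qed.

(** A full block of [j] digits [m - 1] is erased and passes [clear] on to the
    digits above it. *)
Lemma clear_mul_pow_pred j q : clear (m ^ j * q + (m ^ j).-1) = m ^ j * clear q.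
Proof.
elim: j => [|j IHj]; first by rewrite expn0 !mul1n addn0.
have p0 := pow_gt0 j.
have -> : m ^ j.+1 * q + (m ^ j.+1).-1 = m * (m ^ j * q + (m ^ j).-1) + m.-1.
  by rewrite expnS; nia.
by rewrite clear_mulD ?eqxx ?IHj ?expnS ?mulnA //; lia.
Qed.

(** When one of the [j] lowest digits differs from [m - 1], the carry stops
    there and the digits above are left alone. *)
Lemma clear_low_digits j q s :
  s < (m ^ j).-1 -> clear (m ^ j * q + s) = m ^ j * q + clear s.
Proof.
elim: j s => [|j IHj] s; first by rewrite expn0; lia.
rewrite expnS => sm; have p0 := pow_gt0 j.
have m0 : 0 < m by lia.
rewrite [in LHS](divn_eq s m) [s %/ m * m]mulnC.
have -> : m * m ^ j * q + (m * (s %/ m) + s %% m)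
          = m * (m ^ j * q + s %/ m) + s %% m by lia.
rewrite clear_mulD ?ltn_pmod // [clear s]clearE.
have := divn_eq s m; have := ltn_pmod s m0.
move: (s %% m) (s %/ m) => d t dm sE.
case: eqP => [dE|_]; last by lia.
by rewrite IHj; [lia | nia].
Qed.

Lemma clear_pow_pred K : clear (m ^ K).-1 = 0.
Proof.
have := clear_mul_pow_pred K 0.
by rewrite muln0 add0n clear0 muln0.
Qed.

(** * Normal forms as functions on natural numbers *)

(** A normal form with [r] factors [f0] is encoded by the leading exponent [a]
    and the list [c_(r-1); ...; c_0]; [tail_map] is the action of what follows
    [f1^a], and [weight] the number of its generators. *)
Fixpoint tail_map (l : seq nat) (x : nat) : nat :=
  if l is c :: l' then clear ((m ^ size l' * c.+1).-1 + tail_map l' x) else x.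

Fixpoint weight (l : seq nat) : nat :=
  if l is c :: l' then m ^ size l' * c.+1 + weight l' else 0.

Lemma size_le_weight l : size l <= weight l.
Proof. by elim: l => //= c l IHl; have := pow_gt0 (size l); nia. Qed.

Lemma pow_mulS_pred j c : (m ^ j * c.+1).-1 = m ^ j * c + (m ^ j).-1.
Proof. by have := pow_gt0 j; rewrite mulnS; lia. Qed.

Lemma dvdn_tail_map l x : m ^ size l %| tail_map l x.
Proof.
elim: l => [|c l /dvdnP[q qE]] /=; first by rewrite expn0.
rewrite pow_mulS_pred qE.
have -> : m ^ size l * c + (m ^ size l).-1 + q * m ^ size l
          = m ^ size l * (c + q) + (m ^ size l).-1 by lia.
by rewrite clear_mul_pow_pred expnS mulnC dvdn_mul // dvdn_clear.
Qed.

(** The only relation needed to simplify products: a factor [f0] whose exponent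
    does not match the normal form disappears. *)
Lemma clear_add_tail_map a l x : ~~ (m ^ size l %| a.+1) ->
  clear (a + tail_map l x) = clear a + tail_map l x.
Proof.
move=> na; have /dvdnP[q ->] := dvdn_tail_map l x.
set M := m ^ size l in na *; have M0 : 0 < M := pow_gt0 _.
have sM : a %% M < M.-1.
  have := ltn_pmod a M0; rewrite leq_eqVlt => /predU1P[E|]; last by lia.
  case/negP: na; rewrite /dvdn -addn1 -modnDml addn1 E modnn; exact: eqxx.
rewrite {1 2}(divn_eq a M).
have -> : a %/ M * M + a %% M + q * M = M * (a %/ M + q) + a %% M by lia.
by rewrite [_ %/ _ * _]mulnC !clear_low_digits //; lia.
Qed.

Lemma tail_map_rcons l b x :
  tail_map (rcons l b) x = tail_map (rcons l 0) (b + x).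
Proof.
elim: l => [|c l IHl] /=; first by congr clear; lia.
by rewrite IHl !size_rcons.
Qed.

(** On multiples of [m] the first factor [f0] is the identity, all later adders
    are of the form [m k + (m - 1)], and dividing everything by [m] shifts the
    levels down by one.  This is what makes the induction in [tail_map_inj]
    work. *)
Lemma tail_map_rcons0_mul l x : tail_map (rcons l 0) (m * x) = m * tail_map l x.
Proof.
elim: l => [|c l IHl] /=; first by rewrite mul0n add0n clear_mul.
rewrite IHl size_rcons !pow_mulS_pred.
set M := m ^ size l; have M0 : 0 < M := pow_gt0 _.
have -> : m ^ (size l).+1 * c + (m ^ (size l).+1).-1 + m * tail_map l x
          = m * (M * c + M.-1 + tail_map l x) + m.-1.
  by rewrite expnS -/M; nia.
by rewrite clear_mulD ?eqxx //; lia.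
Qed.

Lemma tail_map_rcons0_clear l x y : clear x = clear y ->
  tail_map (rcons l 0) x = tail_map (rcons l 0) y.
Proof.
by move=> xy; elim: l => [|c l IHl] /=; [rewrite mul0n !add0n | rewrite IHl size_rcons].
Qed.

(** Far above the finitely many exponents of [l], a digit is never reached. *)
Lemma tail_map_pow_add l r :
  exists B, forall K, B <= K -> tail_map l (m ^ K + r) = m ^ K + tail_map l r.
Proof.
elim: l => [|c l [B IHl]] /=; first by exists 0.
set s := (_.-1 + tail_map l r); exists (maxn B s.+1) => K.
rewrite geq_max => /andP[BK sK]; rewrite IHl // addnCA -/s.
rewrite -[m ^ K in LHS]muln1 clear_low_digits ?muln1 //.
by have := ltn_expl K hm; lia.
Qed.

(** If [b < b'], then at [x = m ^ K - 1 - b] the left side is independent of [K]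
    because [clear] kills [m ^ K - 1], while the right side keeps [m ^ K]. *)
Lemma last_entry_le a l b a' l' b' x0 :
  (forall x, x0 <= x -> a + tail_map (rcons l b) x = a' + tail_map (rcons l' b') x) ->
  b' <= b.
Proof.
move=> eq_f; rewrite leqNgt; apply/negP => bb'.
have [B HB] := tail_map_pow_add (rcons l' 0) (b' - b).-1.
set C := a + tail_map (rcons l 0) 0.
pose K := maxn B (maxn C (x0 + b)).+1.
have KK := ltn_expl K hm.
have := eq_f ((m ^ K).-1 - b) ltac:(lia); rewrite tail_map_rcons [in RHS]tail_map_rcons.
have -> : b + ((m ^ K).-1 - b) = (m ^ K).-1 by lia.
have -> : b' + ((m ^ K).-1 - b) = m ^ K + (b' - b).-1 by lia.
rewrite HB; last by lia.
rewrite (@tail_map_rcons0_clear _ _ 0); first by lia.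
by rewrite clear_pow_pred clear0.
Qed.

(** With a factor [f0] present, all values are congruent modulo [m]. *)
Lemma translation_neq_rcons a a' l b x0 :
  ~ (forall x, x0 <= x -> a + x = a' + tail_map (rcons l b) x).
Proof.
(* The left side takes consecutive values at x0 and x0 + 1. *)
move=> eq_f; have := eq_f _ (leqnn x0); have := eq_f _ (leqnSn x0).
have dv x : exists q, tail_map (rcons l b) x = m * q.
  have /dvdnP[q ->] := dvdn_tail_map (rcons l b) x.
  by exists (q * m ^ size l); rewrite size_rcons expnS mulnCA.
have [[q ->] [q' ->]] := (dv x0.+1, dv x0) => E E'.
have : m * q = m * q' + 1 by lia.
move/(congr1 (modn^~ m)); rewrite modnMr [_ * q']mulnC modnMDl modn_small //; lia.
Qed.

(** Agreement is assumed only from some [x0] on: the induction step replaces [x]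
    by [m * x - b], which is a genuine subtraction for large [x] only. *)
Lemma tail_map_inj a l a' l' x0 :
  (forall x, x0 <= x -> a + tail_map l x = a' + tail_map l' x) ->
  a = a' /\ l = l'.
Proof.
elim/last_ind: l l' a a' x0 => [|l b IHl] l' a a' x0.
  case/lastP: l' => [|l' b'] eq_f; last by case: (translation_neq_rcons eq_f).
  by have /= := eq_f _ (leqnn x0) => E; split=> //; lia.
case/lastP: l' => [|l' b'] eq_f.
  by case: (@translation_neq_rcons a' a l b x0) => x /eq_f.
have bb' : b = b'.
  apply/eqP; rewrite eqn_leq (last_entry_le eq_f).
  by rewrite (@last_entry_le a' l' b' a l b x0) // => x /eq_f.
rewrite -{}bb' in eq_f *.
have m0 : 0 < m by lia.
have eq_m x : x0 + b <= x -> a + m * tail_map l x = a' + m * tail_map l' x.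
  move=> bx; have := eq_f (m * x - b) ltac:(nia).
  by rewrite tail_map_rcons [in RHS]tail_map_rcons subnKC ?tail_map_rcons0_mul //; nia.
have amod : a %% m = a' %% m.
  have /(congr1 (modn^~ m)) := eq_m _ (leqnn _).
  by rewrite ![_ + m * _]addnC ![m * tail_map _ _]mulnC !modnMDl.
have [|ad ->] := IHl l' (a %/ m) (a' %/ m) (x0 + b).
  move=> x /eq_m; rewrite {1}(divn_eq a m) {1}(divn_eq a' m) amod => E.
  by apply/eqP; rewrite -(eqn_pmul2l m0); apply/eqP; lia.
by split=> //; rewrite (divn_eq a m) (divn_eq a' m) amod ad.
Qed.

End Naturals.

(** * Growth of an automaton as a count of products *)

Local Open Scope classical_set_scope.

Lemma card_fset_set_seq (T : choiceType) (S : set T) (s : seq T) :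
  (forall x, S x <-> x \in s) -> #|` fset_set S|%fset = size (undup s).
Proof.
move=> Ss; have -> : S = [set` seq_fset tt s].
  apply/funext => x; apply/propext; rewrite Ss -(seq_fsetE tt).
  by split.
by rewrite set_fsetK size_seq_fset.
Qed.

Section Automata.
Variable X : finType.
Implicit Type A : mealy X.

Definition causal (f : oword X -> oword X) : Prop :=
  forall w w' k, (forall i, i <= k -> w i = w' i) -> f w k = f w' k.

Lemma causal_comp f g : causal f -> causal g -> causal (f \o g).
Proof.
move=> cf cg w w' k ww'; apply: cf => i ik; apply: cg => j ji.
by apply: ww'; exact: leq_trans ik.
Qed.

Lemma causal_act A (q : A) : causal (mealy_act q).
Proof.
move=> w w' k ww'; rewrite /mealy_act ww' //; congr mealy_out.
elim: k ww' => //= k IHk ww'; rewrite ww' // IHk // => i ik.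
by apply: ww'; exact: leqW.
Qed.

(** [pick] depends only on the extension of its predicate, so states with the
    same action get the same representative. *)
Definition class_repr A (q : A) : A :=
  odflt q [pick p : A | `[< mealy_act p = mealy_act q >]].

Lemma act_class_repr A (q : A) : mealy_act (class_repr q) = mealy_act q.
Proof. by rewrite /class_repr; case: pickP => //= p /asboolP. Qed.

Lemma class_repr_eq A (p q : A) :
  mealy_act p = mealy_act q -> class_repr p = class_repr q.
Proof.
rewrite /class_repr => pq; under eq_pick do rewrite pq.
by case: pickP => //= /(_ q); rewrite asboolT.
Qed.

Lemma class_reprK A (q : A) : class_repr (class_repr q) == class_repr q.
Proof. exact/eqP/class_repr_eq/act_class_repr. Qed.

Definition reduced_state A : finType := {q : A | class_repr q == q}.

Definition reduce A (q : A) : reduced_state A :=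
  exist _ (class_repr q) (class_reprK q).

Definition reduced A : mealy X :=
  @Mealy X (reduced_state A)
    (fun s x => reduce (mealy_next (val s) x)) (fun s x => mealy_out (val s) x).

Lemma act_reduced A (s : reduced A) : mealy_act s = mealy_act (val s).
Proof.
apply/funext => w; apply/funext => k.
elim: k s w => [//|k IHk] s w.
have -> : w = ocons (w 0) (fun i => w i.+1) by apply/funext => -[].
rewrite !mealy_act_cons; apply: etrans (IHk _ _) _.
by rewrite act_class_repr.
Qed.

Lemma reduced_equiv A : mealy_equiv (reduced A) A.
Proof.
rewrite /mealy_equiv /transformations; apply/seteqP; split => _ [q _ <-].
  by exists (val q); rewrite ?act_reduced.
by exists (reduce q) => //; rewrite act_reduced act_class_repr.
Qed.

Lemma act_reduced_inj A : injective (@mealy_act X (reduced A)).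
Proof.
move=> p q; rewrite !act_reduced => /class_repr_eq pq.
by apply: val_inj; rewrite -(eqP (valP p)) -(eqP (valP q)).
Qed.

Lemma card_transformations A :
  #|` fset_set (transformations A)|%fset = size (undup (map (@mealy_act X A) (enum A))).
Proof.
apply: card_fset_set_seq => f; split=> [[q _ <-]|/mapP[q _ ->]]; last by exists q.
by rewrite map_f // mem_enum.
Qed.

(** At least one state is needed for each transformation, and [reduced] uses no
    more. *)
Lemma minimal_sizeE A : minimal_size A = #|` fset_set (transformations A)|%fset.
Proof.
rewrite /minimal_size; case: ex_minnP => k /asboolP[B BA <-] kmin.
apply/eqP; rewrite eqn_leq; apply/andP; split; last first.
  rewrite -BA card_transformations (leq_trans (size_undup _)) //.
  by rewrite size_map cardE.
rewrite -(reduced_equiv A) card_transformations undup_id; last first.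
  by rewrite map_inj_uniq ?enum_uniq //; exact: act_reduced_inj.
rewrite size_map -cardE; apply: kmin; apply/asboolP.
by exists (reduced A) => //; exact: reduced_equiv.
Qed.

Lemma transformations_pow A n :
  transformations (mealy_pow A n) = products (transformations A) n.
Proof.
elim: n => [|n IHn] /=.
  by apply/seteqP; split=> f /= => [[[] _ <-]|->]; [|exists tt].
rewrite -IHn; apply/seteqP; split => f /=.
  move=> [[p q] _ <-]; exists (mealy_act p); first by exists p.
  by exists (mealy_act q); [exists q | rewrite mealy_act_prod].
move=> [_ [p _ <-]] [_ [q _ <-]] <-.
by exists (p, q); rewrite ?mealy_act_prod.
Qed.

Lemma products_id (G : set (oword X -> oword X)) n : G id -> products G n id.
Proof. by move=> Gid; elim: n => //= n IHn; exists id => //; exists id. Qed.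

(** The identity being a generator, products can be padded. *)
Lemma products_le (G : set (oword X -> oword X)) l n :
  G id -> l <= n -> products G l `<=` products G n.
Proof.
move=> Gid; elim: l n => [|l IHl] n; last case: n => [|n] //=.
  by move=> _ f ->; exact: products_id.
by move=> ln f [g Gg [h Gh <-]]; exists g => //; exists h => //; exact: IHl Gh.
Qed.

Lemma products_sub_semigroup A n : transformations A id ->
  products (transformations A) n `<=` mealy_semigroup A.
Proof.
move=> Gid; elim: n => [|n IHn] /= f.
  by move=> -> S [_]; apply.
move=> [g Gg [h /IHn Gh <-]] S SA; have [Scomp SG] := SA.
by apply: Scomp; [exact: SG | exact: Gh].
Qed.

Lemma ballE A n : transformations A id ->
  ball A n = products (transformations A) n.
Proof.
move=> Gid; apply/seteqP; split => f.
  move=> [_ [l [[-> _]|[_ [fl _]]] ln]]; first exact: products_id.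
  exact: (products_le Gid ln).
move=> fn; split; first exact: products_sub_semigroup fn.
have [->|f1] := pselect (f = id); first by exists 0 => //; left.
have Pex : exists l, `[< products (transformations A) l f >].
  by exists n; apply/asboolP.
case: (ex_minnP Pex) => l /asboolP fl lmin; exists l.
  by right; split=> //; split=> // l' fl'; apply: lmin; apply/asboolP.
by apply: lmin; apply/asboolP.
Qed.

End Automata.

(** * Normal forms in the automaton semigroup *)

Section NormalForms.
Variable m : nat.
Hypothesis hm : 1 < m.

Let m0 : 0 < m := ltnW hm.
Local Notation f0 := (mealy_act (J_f0 : J m)).
Local Notation f1 := (mealy_act (J_f1 : J m)).
Local Notation G := (transformations (J m)).

Definition digits (n : nat) : oword 'I_m :=
  fun k => Ordinal (ltn_pmod (n %/ m ^ k) m0).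

Lemma digits_cons n :
  digits n = ocons (Ordinal (ltn_pmod n m0)) (digits (n %/ m)).
Proof.
apply/funext => -[|k] /=; apply: val_inj => /=; first by rewrite expn0 divn1.
by rewrite expnS divnMA.
Qed.

Lemma digits_succ n k : digits n k.+1 = digits (n %/ m) k.
Proof. by rewrite digits_cons. Qed.

Lemma digits_inj : injective digits.
Proof.
(* Dividing both arguments by m decreases their sum unless both are 0. *)
move=> n n'; have [N] := ubnP (n + n'); elim: N n n' => // N IHN n n' nN nn'.
have [/eqP|n0] := posnP (n + n'); first by rewrite addn_eq0 => /andP[/eqP-> /eqP->].
have nm : n %% m = n' %% m.
  by have := congr1 (fun w : oword 'I_m => val (w 0)) nn'; rewrite /= !divn1.
rewrite (divn_eq n m) (divn_eq n' m) nm (IHN (n %/ m) (n' %/ m)) //.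
  have half p : (p %/ m) * 2 <= p.
    by apply: leq_trans (leq_trunc_div p m); rewrite leq_mul2l hm orbT.
  by have := half n; have := half n'; lia.
by apply/funext => k; rewrite -!digits_succ nn'.
Qed.

Lemma digits_prefix (w : oword 'I_m) k :
  exists n, forall i, i <= k -> digits n i = w i.
Proof.
elim: k w => [|k IHk] w.
  exists (w 0) => -[|//] _; apply: val_inj => /=.
  by rewrite expn0 divn1 modn_small.
have [n Hn] := IHk (fun i => w i.+1).
exists (m * n + w 0) => -[|i] ik; rewrite digits_cons /=.
  by apply: val_inj; rewrite /= mulnC modnMDl modn_small.
by rewrite mulnC divnMDl // divn_small // addn0 Hn.
Qed.

Lemma act_f0_digits n : f0 (digits n) = digits (clear m n).
Proof.
apply/funext => k; elim: k n => [|k IHk] n.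
  rewrite digits_cons J_act_f0 [in RHS]digits_cons; apply: val_inj => /=.
  by rewrite (clearE hm) modnMr.
rewrite digits_cons J_act_f0 [in RHS]digits_cons /= (clearE hm) mulKn //.
by case: eqP.
Qed.

Lemma act_f1_digits n : f1 (digits n) = digits n.+1.
Proof.
apply/funext => k; elim: k n => [|k IHk] n.
all: rewrite digits_cons J_act_f1 [in RHS]digits_cons.
  by apply: val_inj => /=; rewrite -addn1 -(addn1 n) modnDml.
rewrite /=; case: eqP => nm.
  rewrite IHk; congr (digits _ k); have := divn_eq n m; rewrite nm => nE.
  by rewrite [n in RHS]nE -addnS prednK // -mulSnr mulnK.
congr (digits _ k); have := ltn_pmod n m0; rewrite {3}(divn_eq n m) => nlt.
move: (n %% m) (n %/ m) nm nlt => d q nm nlt.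
by rewrite -addnS divnMDl // divn_small ?addn0 //; lia.
Qed.

(** A causal map is determined by its values on the dense set of words
    [digits n], see [extends_eq]. *)
Definition extends (f : oword 'I_m -> oword 'I_m) (phi : nat -> nat) : Prop :=
  causal f /\ forall n, f (digits n) = digits (phi n).

Lemma extends_comp f g phi psi :
  extends f phi -> extends g psi -> extends (f \o g) (phi \o psi).
Proof.
move=> [cf fp] [cg gp]; split; first exact: causal_comp.
by move=> n /=; rewrite gp fp.
Qed.

Lemma extends_eq f g phi psi :
  extends f phi -> extends g psi -> f = g <-> phi =1 psi.
Proof.
move=> [cf fp] [cg gp]; split=> [fg n|pp]; first by apply: digits_inj; rewrite -fp fg gp.
apply/funext => w; apply/funext => k; have [n Hn] := digits_prefix w k.
have Hn' i : i <= k -> w i = digits n i by move/Hn.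
by rewrite (cf _ _ _ Hn') (cg _ _ _ Hn') fp gp pp.
Qed.

Lemma extends_f0 : extends f0 (clear m).
Proof. by split; [exact: causal_act | exact: act_f0_digits]. Qed.

Lemma extends_f1_iter a : extends (iter a f1) (addn a).
Proof.
elim: a => [|a IHa]; first by split=> [w w' k|n] //=; apply.
apply: (@extends_comp f1 _ succn); last exact: IHa.
by split; [exact: causal_act | exact: act_f1_digits].
Qed.

Fixpoint tail_act (l : seq nat) : oword 'I_m -> oword 'I_m :=
  if l is c :: l' then f0 \o (iter (m ^ size l' * c.+1).-1 f1 \o tail_act l') else id.

Definition nf_act (s : nat * seq nat) := iter s.1 f1 \o tail_act s.2.

Definition nf_weight (s : nat * seq nat) := s.1 + weight m s.2.

Lemma extends_tail_act l : extends (tail_act l) (tail_map m l).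
Proof.
elim: l => [|c l IHl]; first by split=> [w w' k|n] //=; apply.
apply: (extends_comp extends_f0 (extends_comp (extends_f1_iter _) IHl)).
Qed.

Lemma extends_nf_act s : extends (nf_act s) (fun x => s.1 + tail_map m s.2 x).
Proof. exact: extends_comp (extends_f1_iter _) (extends_tail_act _). Qed.

Lemma nf_act_inj : injective nf_act.
Proof.
move=> [a l] [a' l'] /(extends_eq (extends_nf_act _) (extends_nf_act _)) /= E.
by have [|-> ->] := @tail_map_inj m hm a l a' l' 0.
Qed.

Lemma gen_id : G id.
Proof. by exists (J_e : J m) => //; exact: J_act_e. Qed.

(** Either the exponent has the shape required by the normal form and [f0] opens
    a new factor, or [f0] is absorbed. *)
Lemma f0_nf_act s :
  exists2 t, nf_weight t <= (nf_weight s).+1 & f0 \o nf_act s = nf_act t.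
Proof.
case: s => a l; have M0 := pow_gt0 hm (size l).
have [/dvdnP[[|q] qE]|na] := boolP (m ^ size l %| a.+1); first by [].
  exists (0, q :: l); first by rewrite /nf_weight /= mulnC -qE; lia.
  by rewrite /nf_act /= [m ^ _ * _]mulnC -qE.
exists (clear m a, l); first by rewrite /nf_weight /=; have := clear_le hm a; lia.
apply/(extends_eq (extends_comp extends_f0 (extends_nf_act _)) (extends_nf_act _)).
by move=> x /=; exact: clear_add_tail_map.
Qed.

Lemma products_nf_act n f : products G n f ->
  exists2 s, nf_weight s <= n & f = nf_act s.
Proof.
elim: n f => [|n IHn] f /= => [->|[g [q _ <-] [h /IHn[s sn ->] <-]]].
  by exists (0, [::]).
case: q => /=.
- by exists s; [exact: leqW | rewrite J_act_e].
- by have [t ts ->] := f0_nf_act s; exists t => //; exact: leq_trans ts _.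
- by exists (s.1.+1, s.2).
Qed.

Lemma products_f1_iter a n f :
  products G n f -> products G (a + n) (iter a f1 \o f).
Proof.
move=> fn; elim: a => //= a IHa.
by exists f1; [exists (J_f1 : J m) | exists (iter a f1 \o f)].
Qed.

Lemma nf_act_products n s : nf_weight s <= n -> products G n (nf_act s).
Proof.
move=> sn; apply: (products_le gen_id sn); case: s {sn} => a l.
apply: products_f1_iter => /=; elim: l => //= c l IHl.
have M0 := pow_gt0 hm (size l).
have -> : m ^ size l * c.+1 + weight m l
          = ((m ^ size l * c.+1).-1 + weight m l).+1 by nia.
exists f0; first by exists (J_f0 : J m).
by exists (iter (m ^ size l * c.+1).-1 f1 \o tail_act l) => //; exact: products_f1_iter.
Qed.

Lemma productsE n : products G n = [set nf_act s | s in [set s | nf_weight s <= n]].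
Proof.
apply/seteqP; split=> f; first by move=> /products_nf_act[s sn ->]; exists s.
by move=> [s sn <-]; exact: nf_act_products.
Qed.

(** * Enumeration of the normal forms *)

(** The index [i] stands for [m ^ r' * c.+1], the weight of the head [c], so that
    the recursion has the shape of a convolution of power series. *)
Fixpoint tails (r n : nat) : seq (seq nat) :=
  if r is r'.+1 then
    [seq (i %/ m ^ r').-1 :: l |
      i <- [seq i <- iota 0 n.+1 | (0 < i) && (m ^ r' %| i)], l <- tails r' (n - i)]
  else if n == 0 then [:: [::]] else [::].

Lemma mem_tails r n l : (l \in tails r n) = (size l == r) && (weight m l == n).
Proof.
elim: r n l => [|r IHr] n l.
  by case: n l => [|n] [|c l].
have M0 := pow_gt0 hm r.
apply/allpairsPdep/idP => [[i [l' []]]|].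
  rewrite mem_filter mem_iota IHr => /andP[/andP[i0 /dvdnP[q iE]] ilt].
  move=> /andP[/eqP ls /eqP lw] ->; rewrite /= ls lw eqxx /=.
  have q0 : 0 < q by case: q iE => //; lia.
  by rewrite iE mulnK // prednK // mulnC -iE; lia.
case: l => [|c l] //= /andP[]; rewrite eqSS => /eqP ls /eqP lw.
exists (m ^ r * c.+1), l; split.
- rewrite mem_filter dvdn_mulr // mem_iota -lw ls; lia.
- by rewrite IHr ls -lw ls eqxx /=; lia.
- by rewrite mulKn.
Qed.

Lemma uniq_tails r n : uniq (tails r n).
Proof.
elim: r n => [|r IHr] n; first by rewrite /=; case: eqP.
apply: allpairs_uniq_dep; first by rewrite filter_uniq ?iota_uniq.
  by move=> i _; exact: IHr.
have M0 := pow_gt0 hm r.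
move=> _ _ /allpairsPdep[i [l [+ _ ->]]] /allpairsPdep[i' [l' [+ _ ->]]] /=.
rewrite !mem_filter => /andP[/andP[i0 /dvdnP[q iE]] _] /andP[/andP[i'0 /dvdnP[q' iE']] _].
move=> [+ ->]; rewrite iE iE' !mulnK // => qq'.
have q0 : 0 < q by case: q iE {qq'} => //; lia.
have q0' : 0 < q' by case: q' iE' {qq'} => //; lia.
by have -> : q = q' by lia.
Qed.

Definition tails_of_weight n := [seq l | r <- iota 0 n.+1, l <- tails r n].

Lemma mem_tails_of_weight n l : (l \in tails_of_weight n) = (weight m l == n).
Proof.
apply/allpairsPdep/idP => [[r [l' [_ + ->]]]|/eqP lw].
  by rewrite mem_tails => /andP[].
exists (size l), l; rewrite mem_tails lw !eqxx mem_iota; split=> //.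
by rewrite ltnS -lw size_le_weight.
Qed.

Lemma uniq_tails_of_weight n : uniq (tails_of_weight n).
Proof.
apply: allpairs_uniq_dep; [exact: iota_uniq | by move=> *; exact: uniq_tails |].
move=> _ _ /allpairsPdep[r [l [_ + ->]]] /allpairsPdep[r' [l' [_ + ->]]] /=.
by rewrite !mem_tails => /andP[/eqP <- _] /andP[/eqP <- _] ->.
Qed.

Definition normal_forms n : seq (nat * seq nat) :=
  [seq s | k <- iota 0 n.+1,
           s <- [seq (a, l) | a <- iota 0 (n - k).+1, l <- tails_of_weight k]].

Lemma mem_normal_forms n s : (s \in normal_forms n) = (nf_weight s <= n).
Proof.
apply/allpairsPdep/idP => [[k [t [+ + ->]]]|].
  rewrite mem_iota => kn /allpairsP[[a l] [+ + ->]].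
  by rewrite mem_iota mem_tails_of_weight /nf_weight /= => an /eqP->; lia.
case: s => a l sn; have {}sn : a + weight m l <= n := sn.
exists (weight m l), (a, l); rewrite mem_iota; split=> //; first by lia.
by rewrite allpairs_f // ?mem_iota ?mem_tails_of_weight //; lia.
Qed.

Lemma uniq_normal_forms n : uniq (normal_forms n).
Proof.
apply: allpairs_uniq_dep; first exact: iota_uniq.
  move=> k _; apply: allpairs_uniq; [exact: iota_uniq | exact: uniq_tails_of_weight |].
  by move=> [a l] [a' l'].
move=> _ _ /allpairsPdep[k [s [_ + ->]]] /allpairsPdep[k' [s' [_ + ->]]] /=.
move=> /allpairsP[[a l] [_ + ->]] /allpairsP[[a' l'] [_ + ->]].
by rewrite !mem_tails_of_weight => /eqP <- /eqP <- [-> ->].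
Qed.

Lemma size_tails r n : size (tails r.+1 n) =
  \sum_(i < n.+1) ((0 < i) && (m ^ r %| i)) * size (tails r (n - i)).
Proof.
rewrite size_allpairs_dep sumnE big_map big_filter -(big_mkord xpredT
  (fun i => ((0 < i) && (m ^ r %| i)) * size (tails r (n - i)))) /index_iota subn0.
by rewrite big_mkcond; apply: eq_bigr => i _; case: ifP; rewrite ?mul1n ?mul0n.
Qed.

Lemma size_tails_of_weight n :
  size (tails_of_weight n) = \sum_(r < n.+1) size (tails r n).
Proof.
rewrite size_allpairs_dep sumnE big_map -(big_mkord xpredT
  (fun r => size (tails r n))).
by rewrite /index_iota subn0.
Qed.

Lemma size_normal_forms n :
  size (normal_forms n) = \sum_(k < n.+1) (n - k).+1 * size (tails_of_weight k).
Proof.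
rewrite size_allpairs_dep sumnE big_map -(big_mkord xpredT
  (fun k => (n - k).+1 * size (tails_of_weight k))) /index_iota subn0.
by apply: eq_bigr => k _; rewrite size_allpairs size_iota.
Qed.

Lemma card_products n : #|` fset_set (products G n)|%fset = size (normal_forms n).
Proof.
rewrite -(size_map nf_act) -[in RHS](undup_id (s := map nf_act _)).
  apply: card_fset_set_seq => f; rewrite productsE; split=> [[s sn <-]|/mapP[s + ->]].
    by rewrite map_f // mem_normal_forms.
  by rewrite mem_normal_forms; exists s.
by rewrite (map_inj_uniq nf_act_inj) uniq_normal_forms.
Qed.

Lemma automaton_growthE n : automaton_growth (J m) n = size (normal_forms n).
Proof. by rewrite /automaton_growth minimal_sizeE transformations_pow card_products. Qed.

Lemma semigroup_growthE n : semigroup_growth (J m) n = size (normal_forms n).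
Proof. by rewrite /semigroup_growth (ballE _ gen_id) card_products. Qed.

Lemma tails_small r n : n < r -> tails r n = [::].
Proof.
move=> nr; case E: (tails r n) => [//|l s].
have : l \in tails r n by rewrite E mem_head.
rewrite mem_tails => /andP[/eqP lr /eqP lw].
by have := size_le_weight hm l; rewrite lr lw leqNgt nr.
Qed.

End NormalForms.

(** * Power series *)

Import GRing.Theory.
Local Open Scope ring_scope.

Section Series.
Local Notation X := (fpsX int).

Lemma fps_coef_sum (R : comUnitRingType) (I : Type) (s : seq I) (F : I -> fps R) n :
  fps_coef (\sum_(i <- s) F i) n = \sum_(i <- s) fps_coef (F i) n.
Proof. by apply: (big_morph (fun f : fps R => fps_coef f n)). Qed.

Lemma fps_coefM (R : comUnitRingType) (f g : fps R) n :
  fps_coef (f * g) n = \sum_(i < n.+1) fps_coef f i * fps_coef g (n - i).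
Proof. by []. Qed.

Lemma fps_coefXM (R : comUnitRingType) (f : fps R) n :
  fps_coef (fpsX R * f) n = if n is n'.+1 then fps_coef f n' else 0.
Proof.
rewrite fps_coefM; case: n => [|n]; first by rewrite big_ord1 mul0r.
rewrite big_ord_recl mul0r add0r big_ord_recl mul1r big1 ?addr0 ?subSS ?subn0 //.
by move=> i _; rewrite mul0r.
Qed.

Lemma fps_coefXnM (R : comUnitRingType) (f : fps R) k n :
  fps_coef (fpsX R ^+ k * f) n = if (k <= n)%N then fps_coef f (n - k) else 0.
Proof.
elim: k n => [|k IHk] n; first by rewrite expr0 mul1r subn0.
by rewrite exprS -mulrA fps_coefXM; case: n => //= n; rewrite IHk ltnS subSS.
Qed.

Lemma fps_geometric (R : comUnitRingType) k : (0 < k)%N ->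
  (1 - fpsX R ^+ k)^-1 = FPS (fun n => (k %| n)%:R).
Proof.
move=> k0; set g := FPS _.
have gE : (1 - fpsX R ^+ k) * g = 1.
  apply: fps_ext => n; rewrite mulrBl mul1r.
  rewrite [LHS](_ : _ = fps_coef g n - fps_coef (fpsX R ^+ k * g) n) //.
  rewrite fps_coefXnM /=; case: leqP => kn.
    rewrite -{1}(subnK kn) dvdn_addl // subrr.
    by case: n kn => // kn; move: (leq_ltn_trans kn k0); rewrite ltnn.
  rewrite subr0; case: n kn => [|n] kn; first by rewrite dvdn0.
  by rewrite gtnNdvd.
have U : (1 - fpsX R ^+ k) \is a GRing.unit by apply/unitrPr; exists g.
by apply: (mulrI U); rewrite mulrV // gE.
Qed.

Lemma fps_factor (R : comUnitRingType) k : (0 < k)%N ->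
  fpsX R ^+ k / (1 - fpsX R ^+ k) = FPS (fun n => ((0 < n) && (k %| n))%N%:R).
Proof.
move=> k0; apply: fps_ext => n; rewrite fps_geometric // fps_coefXnM /=.
case: ifPn => [kn|]; first by rewrite (leq_trans k0 kn) -{2}(subnK kn) dvdn_addl.
by rewrite -ltnNge => nk; case: posnP => [->|n0] //=; rewrite gtnNdvd.
Qed.

Lemma fps_inv_sqr (R : comUnitRingType) :
  1 / (1 - fpsX R) ^+ 2 = FPS (fun n => n.+1%:R).
Proof.
rewrite div1r -exprVn -[fpsX R]expr1 fps_geometric // expr2.
apply: fps_ext => n; rewrite fps_coefM /=.
by under eq_bigr do rewrite !dvd1n mulr1; rewrite sumr_const card_ord.
Qed.

Variable m : nat.
Hypothesis hm : (1 < m)%N.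

Local Notation nested_term r := (\prod_(i < r) (X ^+ (m ^ i) / (1 - X ^+ (m ^ i)))).

Lemma coef_nested_term r n : fps_coef (nested_term r) n = (size (tails m r n))%:R.
Proof.
elim: r n => [|r IHr] n; first by rewrite big_ord0 /=; case: n.
have -> : nested_term r.+1 = X ^+ (m ^ r) / (1 - X ^+ (m ^ r)) * nested_term r.
  by rewrite big_ord_recr [RHS]mulrC.
rewrite fps_factor ?pow_gt0 // fps_coefM size_tails natr_sum.
by apply: eq_bigr => i _; rewrite IHr /= natrM.
Qed.

Definition nested_sum : fps int :=
  FPS (fun n => \sum_(k < n) fps_coef (nested_term k.+1) n).

(** Each list of length [r] has weight at least [r], hence only the first [n]
    terms contribute to the coefficient of [X ^+ n]. *)
Lemma nested_sumP : fps_sums_to (fun k => nested_term k.+1) nested_sum.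
Proof.
move=> n; exists n => K nK; rewrite fps_coef_sum /=.
rewrite -(subnKC nK) big_split_ord /= [X in _ + X]big1 ?addr0 // => k _.
by rewrite coef_nested_term tails_small // ltnS leq_addr.
Qed.

Lemma coef_one_add_nested_sum n :
  fps_coef (1 + nested_sum) n = (size (tails_of_weight m n))%:R.
Proof.
rewrite size_tails_of_weight natr_sum big_ord_recl /=.
by congr (_ + _); [case: n | apply: eq_bigr => i _; rewrite coef_nested_term].
Qed.

Lemma normal_forms_series :
  growth_series (fun n => size (normal_forms m n)) = 1 / (1 - X) ^+ 2 * (1 + nested_sum).
Proof.
apply: fps_ext => n; rewrite mulrC fps_inv_sqr fps_coefM.
transitivity ((size (normal_forms m n))%:R : int); first by rewrite natz.
rewrite size_normal_forms natr_sum; apply: eq_bigr => k _.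
by rewrite coef_one_add_nested_sum natrM mulrC.
Qed.

End Series.

Theorem theorem2p3 (m : nat) (hm : (2 <= m)%N) :
  let X := fpsX int in
  growth_series (automaton_growth (J m)) = growth_series (semigroup_growth (J m)) /\
  exists2 N : fps int,
    fps_sums_to
      (fun k => \prod_(i < k.+1) (X ^+ (m ^ i) / (1 - X ^+ (m ^ i)))) N &
    growth_series (automaton_growth (J m)) = 1 / (1 - X) ^+ 2 * (1 + N).
Proof.
have growthE : automaton_growth (J m) = fun n => size (normal_forms m n).
  by apply/funext => n; exact: automaton_growthE.
have semigroupE : semigroup_growth (J m) = fun n => size (normal_forms m n).
  by apply/funext => n; exact: semigroup_growthE.
rewrite growthE semigroupE; split=> //.
by exists (nested_sum m); [exact: nested_sumP | exact: normal_forms_series].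
Qed.
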